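(* Let $G$ and $H$ be finite groups acting on themselves by conjugation and each of which acts on the other. If $G$ acts on $H$ trivially, then Inassaridze's tensor product $G\otimes H$ is finite.
   Context: All actions are left actions by automorphisms. $G$ acts on $H$ and $H$ acts on $G$ (no compatibility between these actions is assumed), and each group acts on itself by conjugation; ${}^{a}b$ denotes the result of acting by $a$ on $b$. Consequently the free product $G*H$ acts on $G$ and on $H$. Inassaridze's tensor product $G\otimes H$ is the group generated by the symbols $g\otimes h$ ($g\in G$, $h\in H$) subject to the relations $gg'\otimes h=({}^{g}g'\otimes{}^{g}h)(g\otimes h)$, $g\otimes hh'=(g\otimes h)({}^{h}g\otimes{}^{h}h')$ and $(g\otimes h)(g'\otimes h')(g\otimes h)^{-1}={}^{[g,h]}g'\otimes{}^{[g,h]}h'$ for all $g,g'\in G$, $h,h'\in H$, where $[g,h]=ghg^{-1}h^{-1}\in G*H$. *)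

(* Defs.v *)
From HB Require Import structures.
From mathcomp Require Import all_boot.
From mathcomp Require Import boolp classical_sets functions cardinality.

Set Implicit Arguments.
Unset Strict Implicit.
Unset Printing Implicit Defensive.

Local Open Scope group_scope.
Local Open Scope quotient_scope.

(* Presentations <X | R> whose group is not assumed finite. Elements are
   classes of words in the letters (b, x); (true, x) is the formal inverse of
   the generator x. *)

Definition word (X : Type) : Type := seq (bool * X).

Definition gen_word (X : Type) (x : X) : word X := [:: (false, x)].

Definition letter_inv (X : Type) (l : bool * X) : bool * X := (~~ l.1, l.2).

Definition word_inv (X : Type) (w : word X) : word X :=
  rev (map (@letter_inv X) w).

(* The least congruence containing R for which letter_inv gives inverses. *)
Inductive pres_eq (X : Type) (R : word X -> word X -> Prop) :
  word X -> word X -> Prop :=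
| PresRel u v of R u v : pres_eq R u v
| PresCancel l : pres_eq R [:: l; letter_inv l] [::]
| PresCat u u' v v' of pres_eq R u u' & pres_eq R v v' :
    pres_eq R (u ++ v) (u' ++ v')
| PresRefl u : pres_eq R u u
| PresSym u v of pres_eq R u v : pres_eq R v u
| PresTrans u v w of pres_eq R u v & pres_eq R v w : pres_eq R u w.

Section PresentedGroup.
Variables (X : choiceType) (R : word X -> word X -> Prop).

Definition pres_eqb (u v : seq (bool * X)) : bool := `[< pres_eq R u v >].

Lemma pres_eqb_refl : reflexive pres_eqb.
Proof. by move=> u; apply/asboolP; apply: PresRefl. Qed.

Lemma pres_eqb_sym : symmetric pres_eqb.
Proof. by move=> u v; apply/asboolP/asboolP; apply: PresSym. Qed.

Lemma pres_eqb_trans : transitive pres_eqb.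
Proof.
by move=> v u w /asboolP uv /asboolP vw; apply/asboolP; apply: PresTrans uv vw.
Qed.

Canonical pres_equiv := EquivRel pres_eqb
  pres_eqb_refl pres_eqb_sym pres_eqb_trans.

Definition presented : Type := {eq_quot pres_equiv}.
HB.instance Definition _ := Choice.on presented.
HB.instance Definition _ := EqQuotient.on presented.

Definition class_of_word (w : word X) : presented := \pi_presented w.

Definition pres_gen (x : X) : presented := class_of_word (gen_word x).

Lemma class_of_wordP u v :
  class_of_word u = class_of_word v <-> pres_eq R u v.
Proof.
rewrite /class_of_word; split=> [/eqquotP/asboolP // | uv].
by apply/eqquotP/asboolP.
Qed.

Lemma pres_repr w : pres_eq R (repr (class_of_word w)) w.
Proof. by apply/class_of_wordP; rewrite /class_of_word reprK. Qed.

Lemma class_of_word_repr (x : presented) : class_of_word (repr x) = x.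
Proof. by rewrite /class_of_word reprK. Qed.

Lemma letter_invK : involutive (@letter_inv X).
Proof. by case=> b x; rewrite /letter_inv /= negbK. Qed.

Lemma word_inv_cat (u v : word X) :
  word_inv (u ++ v) = word_inv v ++ word_inv u.
Proof. by rewrite /word_inv map_cat rev_cat. Qed.

Lemma word_invK : involutive (@word_inv X).
Proof.
move=> w; rewrite /word_inv map_rev revK -map_comp -[RHS]map_id.
by apply: eq_map => l /=; rewrite letter_invK.
Qed.

Lemma pres_mulV w : pres_eq R (w ++ word_inv w) [::].
Proof.
elim: w => [|l w IHw]; first exact: PresRefl.
have -> : (l :: w) ++ word_inv (l :: w) =
    [:: l] ++ ((w ++ word_inv w) ++ [:: letter_inv l]).
  by rewrite -(cat1s l w) word_inv_cat -!catA.
apply: PresTrans (PresCancel R l); rewrite -(cat1s l [:: letter_inv l]).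
apply: PresCat; first exact: PresRefl.
rewrite -[X in pres_eq R _ X]cat0s.
by apply: PresCat; [apply: IHw | apply: PresRefl].
Qed.

Lemma pres_Vmul w : pres_eq R (word_inv w ++ w) [::].
Proof. by rewrite -{2}(word_invK w); apply: pres_mulV. Qed.

Lemma pres_inv u v : pres_eq R u v -> pres_eq R (word_inv u) (word_inv v).
Proof.
move=> uv; rewrite -[word_inv u]cats0.
apply: (@PresTrans _ _ _ (word_inv u ++ (v ++ word_inv v))).
  by apply: PresCat; [apply: PresRefl | apply/PresSym/pres_mulV].
rewrite catA -[X in pres_eq R _ X]cat0s; apply: PresCat; last exact: PresRefl.
apply: PresTrans (pres_Vmul u).
by apply: PresCat; [apply: PresRefl | apply: PresSym].
Qed.

Definition pres_one : presented := class_of_word [::].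
Definition pres_mul (x y : presented) : presented :=
  class_of_word (repr x ++ repr y).
Definition pres_invg (x : presented) : presented :=
  class_of_word (word_inv (repr x)).

Lemma pres_mulA : associative pres_mul.
Proof.
move=> x y z; apply/class_of_wordP.
apply: (@PresTrans _ _ _ (repr x ++ (repr y ++ repr z))).
  by apply: PresCat; [apply: PresRefl | apply: pres_repr].
rewrite catA; apply: PresCat; last exact: PresRefl.
exact/PresSym/pres_repr.
Qed.

Lemma pres_mul1 : left_id pres_one pres_mul.
Proof.
move=> x; rewrite -[RHS]class_of_word_repr; apply/class_of_wordP.
rewrite -[X in pres_eq R _ X]cat0s.
by apply: PresCat; [apply: pres_repr | apply: PresRefl].
Qed.

Lemma pres_mulr1 : right_id pres_one pres_mul.
Proof.
move=> x; rewrite -[RHS]class_of_word_repr; apply/class_of_wordP.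
rewrite -[X in pres_eq R _ X]cats0.
by apply: PresCat; [apply: PresRefl | apply: pres_repr].
Qed.

Lemma pres_invM : left_inverse pres_one pres_invg pres_mul.
Proof.
move=> x; apply/class_of_wordP; apply: PresTrans (pres_Vmul (repr x)).
by apply: PresCat; [apply: pres_repr | apply: PresRefl].
Qed.

Lemma pres_mulrV : right_inverse pres_one pres_invg pres_mul.
Proof.
move=> x; apply/class_of_wordP; apply: PresTrans (pres_mulV (repr x)).
by apply: PresCat; [apply: PresRefl | apply: pres_repr].
Qed.

HB.instance Definition _ := isGroup.Build presented
  pres_mulA pres_mul1 pres_mulr1 pres_invM pres_mulrV.

Lemma class_of_word_cat u v :
  class_of_word (u ++ v) = class_of_word u * class_of_word v.
Proof.
by apply/class_of_wordP; apply: PresCat; apply/PresSym/pres_repr.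
Qed.

Lemma class_of_word_inv u : class_of_word (word_inv u) = (class_of_word u)^-1.
Proof. by apply/class_of_wordP/pres_inv/PresSym/pres_repr. Qed.

End PresentedGroup.

(* Left actions by automorphisms. The bijectivity of each laut_fun a follows
   from laut_fun1 and laut_funM. *)
Record left_aut_action (A B : groupType) := LeftAutAction {
  laut_fun :> A -> B -> B;
  laut_fun1 : forall b, laut_fun 1 b = b;
  laut_funM : forall a a' b, laut_fun (a * a') b = laut_fun a (laut_fun a' b);
  laut_fun_morph : forall a b b',
    laut_fun a (b * b') = laut_fun a b * laut_fun a b'
}.

Section Conjugation.
Variable A : groupType.

(* The library's b ^ a is the right action a^-1 * b * a. *)
Definition conj_fun (a b : A) : A := a * b * a^-1.

Lemma conj_fun1 b : conj_fun 1 b = b.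
Proof. by rewrite /conj_fun invg1 mulg1 mul1g. Qed.

Lemma conj_funM a a' b : conj_fun (a * a') b = conj_fun a (conj_fun a' b).
Proof. by rewrite /conj_fun invgM !mulgA. Qed.

Lemma conj_fun_morph a b b' :
  conj_fun a (b * b') = conj_fun a b * conj_fun a b'.
Proof. by rewrite /conj_fun !mulgA mulgVK. Qed.

Definition conj_action : left_aut_action A A :=
  LeftAutAction conj_fun1 conj_funM conj_fun_morph.

End Conjugation.

Section FreeProduct.
Variables G H : groupType.

Inductive free_prod_rel : word (G + H) -> word (G + H) -> Prop :=
| FreeProdL g g' : free_prod_rel (gen_word (inl (g * g')))
                     (gen_word (inl g) ++ gen_word (inl g'))
| FreeProdR h h' : free_prod_rel (gen_word (inr (h * h')))
                     (gen_word (inr h) ++ gen_word (inr h')).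

Definition free_prod := presented free_prod_rel.
HB.instance Definition _ := Group.on free_prod.

Definition free_prod_inl (g : G) : free_prod := pres_gen free_prod_rel (inl g).
Definition free_prod_inr (h : H) : free_prod := pres_gen free_prod_rel (inr h).

(* [g, h] = g h g^-1 h^-1 in G * H; the library's [~ x, y] is
   x^-1 y^-1 x y. *)
Definition free_prod_comm (g : G) (h : H) : free_prod :=
  free_prod_inl g * free_prod_inr h *
  (free_prod_inl g)^-1 * (free_prod_inr h)^-1.

Section Action.
Variables (K : groupType) (aG : left_aut_action G K) (aH : left_aut_action H K).

Definition letter_act (l : bool * (G + H)) (k : K) : K :=
  match l.2 with
  | inl g => aG (if l.1 then g^-1 else g) k
  | inr h => aH (if l.1 then h^-1 else h) k
  end.

Definition word_act (w : word (G + H)) (k : K) : K := foldr letter_act k w.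

Lemma word_act_eq u v : pres_eq free_prod_rel u v -> word_act u =1 word_act v.
Proof.
elim=> {u v} [u v []|[] /= | u u' v v' _ IHu _ IHv k | // | u v _ IH k |
  u v w _ IHu _ IHv k].
- by move=> g g' k; rewrite /word_act /= /letter_act /= laut_funM.
- by move=> h h' k; rewrite /word_act /= /letter_act /= laut_funM.
- by case=> [] [] x k; rewrite /word_act /= /letter_act /= -laut_funM
    ?mulgV ?mulVg laut_fun1.
- by rewrite /word_act !foldr_cat -!/(word_act _ _) IHv IHu.
- by rewrite IH.
- by rewrite IHu.
Qed.

(* Independent of the representative by word_act_eq. *)
Definition free_prod_act_fun (x : free_prod) (k : K) : K :=
  word_act (repr x) k.

Lemma free_prod_act_word w k :
  free_prod_act_fun (class_of_word free_prod_rel w) k = word_act w k.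
Proof. exact/word_act_eq/pres_repr. Qed.

Lemma free_prod_act1 k : free_prod_act_fun 1 k = k.
Proof. exact: free_prod_act_word. Qed.

Lemma free_prod_actM x y k :
  free_prod_act_fun (x * y) k = free_prod_act_fun x (free_prod_act_fun y k).
Proof.
by rewrite [LHS]free_prod_act_word /word_act foldr_cat.
Qed.

Lemma free_prod_act_morph x k k' : free_prod_act_fun x (k * k') =
  free_prod_act_fun x k * free_prod_act_fun x k'.
Proof.
rewrite /free_prod_act_fun; elim: (repr x) => [//|[b [g|h]] w IHw];
by rewrite /= IHw /letter_act /= laut_fun_morph.
Qed.

Definition free_prod_act : left_aut_action free_prod K :=
  LeftAutAction free_prod_act1 free_prod_actM free_prod_act_morph.

Lemma free_prod_act_inl g k : free_prod_act (free_prod_inl g) k = aG g k.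
Proof. exact: free_prod_act_word. Qed.

Lemma free_prod_act_inr h k : free_prod_act (free_prod_inr h) k = aH h k.
Proof. exact: free_prod_act_word. Qed.

End Action.
End FreeProduct.

Section Tensor.
Variables (G H : groupType).
Variables (aGH : left_aut_action G H) (aHG : left_aut_action H G).

Definition free_prod_act_l : left_aut_action (free_prod G H) G :=
  free_prod_act (conj_action G) aHG.
Definition free_prod_act_r : left_aut_action (free_prod G H) H :=
  free_prod_act aGH (conj_action H).

Local Notation "g '⊗' h" := (gen_word (g, h)) (at level 38).

Inductive tensor_rel : word (G * H) -> word (G * H) -> Prop :=
| TensorL g g' h :
    tensor_rel ((g * g') ⊗ h)
               ((conj_action G g g' ⊗ aGH g h) ++ (g ⊗ h))
| TensorR g h h' :
    tensor_rel (g ⊗ (h * h'))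
               ((g ⊗ h) ++ (aHG h g ⊗ conj_action H h h'))
| TensorComm g h g' h' :
    tensor_rel ((g ⊗ h) ++ (g' ⊗ h') ++ word_inv (g ⊗ h))
               (free_prod_act_l (free_prod_comm g h) g' ⊗
                free_prod_act_r (free_prod_comm g h) h').

Definition tensor_product := presented tensor_rel.
HB.instance Definition _ := Group.on tensor_product.

End Tensor.

(* Main.v *)
Require Import Defs.
From mathcomp Require Import all_boot all_fingroup cyclic.
From mathcomp Require Import boolp classical_sets functions cardinality.

(** Since [G] acts trivially on [H], the first relation says that
    [g |-> g ⊗ h] is a homomorphism for each fixed [h], because
    [g g' = (g g' g^-1) g]; hence [(g ⊗ h)^|G| = 1]. The third relation says
    that the finite set of symbols is closed under conjugation. Dietzmann's
    lemma then applies: in a long product of symbols some symbol occurs at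
    least [|G|] times, and moving these occurrences to the end conjugates the
    others into symbols and lets the [|G|] equal factors cancel. *)

Set Implicit Arguments.
Unset Strict Implicit.
Unset Printing Implicit Defensive.

Local Open Scope group_scope.

Section Dietzmann.
Variables (T : groupType) (I : finType) (f : I -> T).
Hypothesis f_conj : forall i j, exists k, f i * f j * (f i)^-1 = f k.

(** Passing [f i] over a factor [f j] turns the latter into [f i * f j * (f i)^-1], again a value of
    [f], so the length is kept. *)
Lemma prod_move_right i (w : seq I) : exists2 w' : seq I,
  size w' = size w & f i * \prod_(j <- w) f j = (\prod_(j <- w') f j) * f i.
Proof.
elim: w => [|j w [w' szw' IHw]].
  by exists [::]; rewrite ?big_nil ?mulg1 ?mul1g.
have [k fk] := f_conj i j.
exists (k :: w'); first by rewrite /= szw'.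
by rewrite !big_cons -mulgA -IHw -fk !mulgA mulgVK.
Qed.

(** A leading [i] is carried past the word already collected. Only the length of [w'] is controlled:
    conjugation may bring the index [i] back into it. *)
Lemma prod_collect_right i (w : seq I) : exists2 w' : seq I,
  (size w' + count_mem i w)%N = size w &
  \prod_(j <- w) f j = (\prod_(j <- w') f j) * f i ^+ count_mem i w.
Proof.
elim: w => [|j w [w' szw' IHw]]; first by exists [::]; rewrite ?big_nil ?mulg1.
rewrite /= big_cons IHw; case: eqVneq => [->|_] /=.
  have [w'' szw'' fw''] := prod_move_right i w'.
  exists w''; first by rewrite szw'' add1n addnS szw'.
  by rewrite add1n expgS !mulgA fw''.
by exists (j :: w'); rewrite ?big_cons ?mulgA //= add0n addSn szw'.
Qed.

Variable m : nat.
Hypotheses (m_gt0 : (0 < m)%N) (f_exp : forall i, f i ^+ m = 1).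

Lemma prod_shorten (w : seq I) : exists2 w' : seq I,
  (size w' <= #|I| * m)%N & \prod_(j <- w) f j = \prod_(j <- w') f j.
Proof.
have [n] := ubnP (size w); elim: n w => // n IHn w /ltnSE szw.
have [|gtw] := leqP (size w) (#|I| * m); first by exists w.
have [i le_m] : exists i, (m <= count_mem i w)%N.
  (* Pigeonhole: the length of [w] is the sum over [i] of its multiplicities, by a double count, so
     it is at most [#|I| * m] if each is below [m]. *)
  apply/existsP; apply: contraTT gtw; rewrite negb_exists => /forallP w_lt.
  rewrite -leqNgt -sum1_size -sum_nat_const.
  rewrite (eq_bigr (fun j => \sum_(i | i == j) 1)%N); last first.
    by move=> j _; rewrite big_pred1_eq.
  rewrite (exchange_big_dep predT) //=; apply: leq_sum => i _.
  rewrite sum1_count; move: (w_lt i); rewrite -ltnNge => /ltnW.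
  by rewrite (eq_count (a2 := [pred j | i == j])) // => j; rewrite /= eq_sym.
have [w' szw' ->] := prod_collect_right i w.
(* Exactly [m] copies of [i] are dropped: the product is unchanged because [f i ^+ m = 1], and the
   word gets strictly shorter because [m] is positive. *)
have [|w'' szw'' eqw''] := IHn (w' ++ nseq (count_mem i w - m) i).
  apply: leq_trans szw; rewrite size_cat size_nseq -szw' ltn_add2l.
  by rewrite ltn_subrL m_gt0 (leq_trans m_gt0).
exists w''; rewrite // -eqw'' big_cat big_nseq iter_mulg_1 /=.
by rewrite -{1}(subnK le_m) expgD f_exp mulg1.
Qed.

Lemma dietzmann :
  (forall x : T, exists w : seq I, x = \prod_(i <- w) f i) ->
  finite_set [set: T]%classic.
Proof.
(* Words of bounded length form a finite type, and by shortening [F] is onto. *)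
move=> f_gen; pose F (w : (#|I| * m).-bseq I) := \prod_(i <- w) f i.
apply: (sub_finite_set (B := range F)); last exact/finite_image/finite_finset.
move=> x _; have [w ->] := f_gen x; have [w' szw' ->] := prod_shorten w.
by exists (Bseq szw').
Qed.

End Dietzmann.

Section TrivialAction.
Variables (G H : finGroupType).
Variables (aGH : left_aut_action G H) (aHG : left_aut_action H G).

Definition tensor (p : G * H) : tensor_product aGH aHG :=
  pres_gen (tensor_rel aGH aHG) p.

Lemma tensor_conj p q :
  exists r, tensor p * tensor q * (tensor p)^-1 = tensor r.
Proof.
case: p q => [g h] [g' h'].
exists (free_prod_act_l aHG (free_prod_comm g h) g',
        free_prod_act_r aGH (free_prod_comm g h) h').
have /class_of_wordP := PresRel (TensorComm aGH aHG g h g' h').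
by rewrite !class_of_word_cat class_of_word_inv mulgA.
Qed.

Hypothesis aGH_trivial : forall g h, aGH g h = h.

Lemma tensorM g g' h : tensor (g * g', h) = tensor (g, h) * tensor (g', h).
Proof.
(* The arguments are chosen so that their product is [g * g'] and conjugating the second by [g']
   gives [g]. *)
have /class_of_wordP := PresRel (TensorL aGH aHG g' (g'^-1 * g * g') h).
by rewrite class_of_word_cat aGH_trivial /= /conj_fun !mulgA mulgV mul1g
  mulgK.
Qed.

Lemma tensor1 h : tensor (1, h) = 1.
Proof. by apply: (mulgI (tensor (1, h))); rewrite -tensorM !mulg1. Qed.

Lemma tensorV g h : tensor (g^-1, h) = (tensor (g, h))^-1.
Proof. by apply: (mulgI (tensor (g, h))); rewrite -tensorM !mulgV tensor1. Qed.

Lemma tensorX g h n : tensor (g ^+ n, h) = tensor (g, h) ^+ n.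
Proof.
by elim: n => [|n IHn]; rewrite ?tensor1 // !expgS tensorM IHn.
Qed.

(** No inverses of symbols are needed: by [tensorV] a formal inverse of [(g, h)] is the symbol of
    [(g^-1, h)]. *)
Lemma tensor_gen (x : tensor_product aGH aHG) :
  exists w : seq (G * H), x = \prod_(p <- w) tensor p.
Proof.
rewrite -[x]class_of_word_repr; elim: (generic_quotient.repr x) =>
  [|[b [g h]] w [w' IHw]].
  by exists [::]; rewrite big_nil.
exists ((if b then g^-1 else g, h) :: w').
rewrite big_cons -IHw -cat1s class_of_word_cat; congr (_ * _).
by case: b; rewrite // tensorV -class_of_word_inv.
Qed.

End TrivialAction.

Theorem theorem6p3 (G H : finGroupType)
    (aGH : left_aut_action G H) (aHG : left_aut_action H G)
    (aGH_trivial : forall (g : G) (h : H), aGH g h = h) :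
  finite_set [set: tensor_product aGH aHG]%classic.
Proof.
apply: (dietzmann (tensor_conj aGH aHG) (m := #|[set: G]|)).
- exact: cardG_gt0.
- by case=> g h; rewrite -tensorX // expg_cardG ?inE // tensor1.
- exact: tensor_gen.
Qed.
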